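(* Let $\rho,t\in\mathbb{R}$ and $E(t)=e^{4(1-2\rho)t}$, and let $g(t)=\frac{dx^2+dy^2}{E(t)+x^2+y^2}$ on $\mathbb{R}^2$. The potential vector field $$\xi=-2(1-2\rho)\left(x\frac{\partial}{\partial x}+y\frac{\partial}{\partial y}\right)$$ of the Cigar almost Ricci--Bourguignon soliton $(\mathbb{R}^2,g(t),\xi,\lambda\equiv0,\rho)$ is a mixed Killing vector field.
   Context: A vector field $V$ on a Riemannian manifold $(M,g)$ is mixed Killing if there is a smooth function $f$ on $M$ with $L_VL_Vg=f\,L_Vg$, where $L_V$ is the Lie derivative along $V$. *)

(* Defs.v *)
From Stdlib Require Import Reals.
From Coquelicot Require Import Coquelicot.
Open Scope R_scope.

(* The manifold is R^2 with its global coordinates (x, y): a tensor field is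
   given by its components in the frame (d/dx, d/dy) and coframe (dx, dy). *)

Inductive axis : Set := ax_x | ax_y.

Definition sum_axis (F : axis -> R) : R := F ax_x + F ax_y.

Definition scalar_field : Type := R -> R -> R.
Definition vector_field : Type := axis -> scalar_field.
Definition tensor02 : Type := axis -> axis -> scalar_field.

Definition partial (k : axis) (f : scalar_field) : scalar_field :=
  fun x y =>
    match k with
    | ax_x => Derive (fun s => f s y) x
    | ax_y => Derive (fun s => f x s) y
    end.

(* [ex_diff_n f n x y]: all iterated partial derivatives of [f] of order at
   most [n] exist (as genuine derivatives) and are continuous at [(x, y)]. *)
Definition smooth (f : scalar_field) : Prop :=
  forall (n : nat) (x y : R), ex_diff_n f n x y.

Definition smooth_vector_field (V : vector_field) : Prop :=
  forall k, smooth (V k).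

Definition riemannian_metric (g : tensor02) : Prop :=
  (forall i j, smooth (g i j)) /\
  (forall i j x y, g i j x y = g j i x y) /\
  (forall (x y : R) (v : axis -> R), (exists k, v k <> 0) ->
     0 < sum_axis (fun i => sum_axis (fun j => g i j x y * v i * v j))).

(* (L_V h)_{ij} = V^k d_k h_{ij} + h_{kj} d_i V^k + h_{ik} d_j V^k,
   i.e. V (h (d_i, d_j)) - h ([V, d_i], d_j) - h (d_i, [V, d_j]),
   since [V, d_i] = - (d_i V^k) d_k. *)
Definition lie_derivative (V : vector_field) (h : tensor02) : tensor02 :=
  fun i j x y =>
    sum_axis (fun k =>
      V k x y * partial k (h i j) x y
      + h k j x y * partial i (V k) x y
      + h i k x y * partial j (V k) x y).

(* The first two conjuncts say that (R^2, g) is a Riemannian manifold and V a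
   vector field on it. *)
Definition mixed_killing (g : tensor02) (V : vector_field) : Prop :=
  riemannian_metric g /\
  smooth_vector_field V /\
  exists f : scalar_field,
    smooth f /\
    forall i j x y,
      lie_derivative V (lie_derivative V g) i j x y
      = f x y * lie_derivative V g i j x y.

Definition cigar_E (rho t : R) : R := exp (4 * (1 - 2 * rho) * t).

Definition cigar_metric (rho t : R) : tensor02 :=
  fun i j x y =>
    match i, j with
    | ax_x, ax_x | ax_y, ax_y => 1 / (cigar_E rho t + x ^ 2 + y ^ 2)
    | _, _ => 0
    end.

Definition cigar_potential (rho : R) : vector_field :=
  fun k x y =>
    match k with
    | ax_x => - 2 * (1 - 2 * rho) * x
    | ax_y => - 2 * (1 - 2 * rho) * y
    end.

(* Main.v *)
Require Import Defs.
From Stdlib Require Import Reals Lra Lia.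
From Coquelicot Require Import Coquelicot.
Open Scope R_scope.

(** Write D = E + x^2 + y^2, r^2 = x^2 + y^2 and c = -2(1 - 2 rho). All the
    tensors involved are conformal to the flat metric: since xi is c times the
    radial field, [L_xi (h delta) = (xi h + 2 c h) delta]. With
    [xi D = 2 c r^2] this gives [L_xi g = 2 c E / D^2 delta] and
    [L_xi L_xi g = 2 c (E - r^2) / D * L_xi g], so f = 2 c (E - r^2) / D. *)

(** * Rules for building and splitting iterated differentiability *)

Lemma ex_diff_n_ext (f h : scalar_field) (n : nat) :
  (forall x y, f x y = h x y) ->
  (forall x y, ex_diff_n f n x y) -> forall x y, ex_diff_n h n x y.
Proof.
  intros Hfh Hf x y; apply ex_diff_n_ext_loc with f; [|now apply Hf].
  now apply locally_2d_forall.
Qed.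

(** [ex_diff_n] recurses on [Derive] terms. These agree everywhere with the explicit partials [fx]
    and [fy], so the inductions below can work with closed forms. *)
Lemma ex_diff_n_S_intro (f fx fy : scalar_field) (n : nat) :
  (forall x y, continuity_2d_pt f x y) ->
  (forall x y, is_derive (fun z => f z y) x (fx x y)) ->
  (forall x y, is_derive (fun z => f x z) y (fy x y)) ->
  (forall x y, ex_diff_n fx n x y) -> (forall x y, ex_diff_n fy n x y) ->
  forall x y, ex_diff_n f (S n) x y.
Proof.
  intros Hc Hdx Hdy Hx Hy x y; simpl; repeat split.
  - apply Hc.
  - eexists; apply Hdx.
  - eexists; apply Hdy.
  - apply (ex_diff_n_ext fx); [|exact Hx].
    intros u v; symmetry; apply is_derive_unique, Hdx.
  - apply (ex_diff_n_ext fy); [|exact Hy].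
    intros u v; symmetry; apply is_derive_unique, Hdy.
Qed.

Lemma ex_diff_n_continuity (f : scalar_field) (n : nat) (x y : R) :
  ex_diff_n f n x y -> continuity_2d_pt f x y.
Proof. destruct n; intros H; apply H. Qed.

Lemma ex_diff_n_S_is_derive_x (f : scalar_field) (n : nat) (x y : R) :
  ex_diff_n f (S n) x y -> is_derive (fun z => f z y) x (partial ax_x f x y).
Proof. intros (_ & H & _); now apply Derive_correct. Qed.

Lemma ex_diff_n_S_is_derive_y (f : scalar_field) (n : nat) (x y : R) :
  ex_diff_n f (S n) x y -> is_derive (fun z => f x z) y (partial ax_y f x y).
Proof. intros (_ & _ & H & _); now apply Derive_correct. Qed.

Lemma ex_diff_n_partial (k : axis) (f : scalar_field) (n : nat) (x y : R) :
  ex_diff_n f (S n) x y -> ex_diff_n (partial k f) n x y.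
Proof. intros (_ & _ & _ & Hx & Hy); now destruct k. Qed.

Lemma ex_diff_n_pred (f : scalar_field) (n : nat) (x y : R) :
  ex_diff_n f (S n) x y -> ex_diff_n f n x y.
Proof. apply ex_diff_n_m; lia. Qed.

Lemma smooth_ext (f h : scalar_field) :
  (forall x y, f x y = h x y) -> smooth f -> smooth h.
Proof. intros Hfh Hf n; now apply (ex_diff_n_ext f). Qed.

(** * Smoothness of constants and coordinates *)

Lemma smooth_const (c : R) : smooth (fun _ _ => c).
Proof.
  (* The partials are the constant 0, so the induction must range over all constants. *)
  intros n; revert c; induction n as [|n IHn]; intros c.
  - intros x y; split; [apply continuity_2d_pt_const | exact I].
  - apply ex_diff_n_S_intro with (fun _ _ => 0) (fun _ _ => 0); auto; intros.
    + apply continuity_2d_pt_const.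
    + apply (is_derive_const c).
    + apply (is_derive_const c).
Qed.

Lemma smooth_x : smooth (fun x _ => x).
Proof.
  (* Case analysis is enough here: the partials are constants, already smooth to every order. *)
  intros [|n].
  - intros x y; split; [apply continuity_2d_pt_id1 | exact I].
  - apply ex_diff_n_S_intro with (fun _ _ => 1) (fun _ _ => 0); intros.
    + apply continuity_2d_pt_id1.
    + apply (is_derive_id x).
    + apply (is_derive_const x).
    + apply smooth_const.
    + apply smooth_const.
Qed.

Lemma smooth_y : smooth (fun _ y => y).
Proof.
  intros [|n].
  - intros x y; split; [apply continuity_2d_pt_id2 | exact I].
  - apply ex_diff_n_S_intro with (fun _ _ => 0) (fun _ _ => 1); intros.
    + apply continuity_2d_pt_id2.
    + apply (is_derive_const y).
    + apply (is_derive_id y).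
    + apply smooth_const.
    + apply smooth_const.
Qed.

(** * Closure under sums, products and inverses *)

Lemma ex_diff_n_plus (n : nat) (f h : scalar_field) :
  (forall x y, ex_diff_n f n x y) -> (forall x y, ex_diff_n h n x y) ->
  forall x y, ex_diff_n (fun u v => f u v + h u v) n x y.
Proof.
  revert f h; induction n as [|n IHn]; intros f h Hf Hh.
  - intros x y; split; [|exact I].
    now apply continuity_2d_pt_plus; apply ex_diff_n_continuity with 0%nat.
  - apply ex_diff_n_S_intro with
      (fun u v => partial ax_x f u v + partial ax_x h u v)
      (fun u v => partial ax_y f u v + partial ax_y h u v); intros.
    + now apply continuity_2d_pt_plus; apply ex_diff_n_continuity with (S n).
    + apply (is_derive_plus (fun z => f z y) (fun z => h z y));
        now apply ex_diff_n_S_is_derive_x with n.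
    + apply (is_derive_plus (fun z => f x z) (fun z => h x z));
        now apply ex_diff_n_S_is_derive_y with n.
    + apply IHn; intros; now apply ex_diff_n_partial.
    + apply IHn; intros; now apply ex_diff_n_partial.
Qed.

(** By the Leibniz rule each partial is a sum of products of a partial with an undifferentiated
    factor. Both are of order n, the latter by [ex_diff_n_pred], so induction over all pairs of
    factors applies. *)
Lemma ex_diff_n_mult (n : nat) (f h : scalar_field) :
  (forall x y, ex_diff_n f n x y) -> (forall x y, ex_diff_n h n x y) ->
  forall x y, ex_diff_n (fun u v => f u v * h u v) n x y.
Proof.
  revert f h; induction n as [|n IHn]; intros f h Hf Hh.
  - intros x y; split; [|exact I].
    now apply continuity_2d_pt_mult; apply ex_diff_n_continuity with 0%nat.
  - apply ex_diff_n_S_intro with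
      (fun u v => partial ax_x f u v * h u v + f u v * partial ax_x h u v)
      (fun u v => partial ax_y f u v * h u v + f u v * partial ax_y h u v);
      intros.
    + now apply continuity_2d_pt_mult; apply ex_diff_n_continuity with (S n).
    + apply (is_derive_mult (fun z => f z y) (fun z => h z y));
        [now apply ex_diff_n_S_is_derive_x with n
        |now apply ex_diff_n_S_is_derive_x with n | exact Rmult_comm].
    + apply (is_derive_mult (fun z => f x z) (fun z => h x z));
        [now apply ex_diff_n_S_is_derive_y with n
        |now apply ex_diff_n_S_is_derive_y with n | exact Rmult_comm].
    + apply ex_diff_n_plus; apply IHn; intros;
        solve [now apply ex_diff_n_partial | now apply ex_diff_n_pred].
    + apply ex_diff_n_plus; apply IHn; intros;
        solve [now apply ex_diff_n_partial | now apply ex_diff_n_pred].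
Qed.

(** The partials of 1/f are - (d f) (1/f)^2. The same reciprocal recurs, so the induction keeps f
    fixed: 1/f has order n by hypothesis, and the product rule gives its partials order n. *)
Lemma ex_diff_n_inv (n : nat) (f : scalar_field) :
  (forall x y, f x y <> 0) -> (forall x y, ex_diff_n f n x y) ->
  forall x y, ex_diff_n (fun u v => / f u v) n x y.
Proof.
  intros Hf0; induction n as [|n IHn]; intros Hf.
  - intros x y; split; [|exact I].
    apply continuity_2d_pt_inv; [|apply Hf0].
    now apply ex_diff_n_continuity with 0%nat.
  - assert (Hi : forall x y, ex_diff_n (fun u v => / f u v) n x y)
      by (apply IHn; intros; now apply ex_diff_n_pred).
    assert (Hd : forall k x y, ex_diff_n
      (fun u v => (-1) * partial k f u v * (/ f u v * / f u v)) n x y).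
    { intros k; apply ex_diff_n_mult; apply ex_diff_n_mult;
        try exact Hi; [intros; apply smooth_const|].
      intros; now apply ex_diff_n_partial. }
    apply ex_diff_n_S_intro with
      (fun u v => (-1) * partial ax_x f u v * (/ f u v * / f u v))
      (fun u v => (-1) * partial ax_y f u v * (/ f u v * / f u v));
      try exact (Hd _); intros.
    + apply continuity_2d_pt_inv; [|apply Hf0].
      now apply ex_diff_n_continuity with (S n).
    (* The product form suits the closure lemma; the quotient form is the one [is_derive_inv]
       yields. *)
    + replace (_ * _ * _) with (- partial ax_x f x y / f x y ^ 2)
        by (field; apply Hf0).
      apply (is_derive_inv (fun z => f z y)); [|apply Hf0].
      now apply ex_diff_n_S_is_derive_x with n.
    + replace (_ * _ * _) with (- partial ax_y f x y / f x y ^ 2)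
        by (field; apply Hf0).
      apply (is_derive_inv (fun z => f x z)); [|apply Hf0].
      now apply ex_diff_n_S_is_derive_y with n.
Qed.

Lemma smooth_plus (f h : scalar_field) :
  smooth f -> smooth h -> smooth (fun x y => f x y + h x y).
Proof. intros Hf Hh n; now apply ex_diff_n_plus. Qed.

Lemma smooth_mult (f h : scalar_field) :
  smooth f -> smooth h -> smooth (fun x y => f x y * h x y).
Proof. intros Hf Hh n; now apply ex_diff_n_mult. Qed.

Lemma smooth_inv (f : scalar_field) :
  (forall x y, f x y <> 0) -> smooth f -> smooth (fun x y => / f x y).
Proof. intros Hf0 Hf n; now apply ex_diff_n_inv. Qed.

(** * The cigar metric and its potential field *)

Lemma cigar_denominator_pos (rho t x y : R) :
  0 < cigar_E rho t + x ^ 2 + y ^ 2.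
Proof.
  unfold cigar_E; assert (H := exp_pos (4 * (1 - 2 * rho) * t)).
  assert (Hx := pow2_ge_0 x); assert (Hy := pow2_ge_0 y); lra.
Qed.

Lemma smooth_cigar_factor (rho t : R) :
  smooth (fun x y => / (cigar_E rho t + x ^ 2 + y ^ 2)).
Proof.
  apply smooth_inv.
  - intros x y; apply Rgt_not_eq, cigar_denominator_pos.
  (* Squares become products so that the closure lemmas apply. *)
  - apply smooth_ext with (fun x y => cigar_E rho t + x * x + y * y).
    + intros x y; ring.
    + apply smooth_plus; [apply smooth_plus|];
        auto using smooth_const, smooth_mult, smooth_x, smooth_y.
Qed.

Lemma cigar_metric_riemannian (rho t : R) :
  riemannian_metric (cigar_metric rho t).
Proof.
  split; [|split].
  - assert (H : smooth (fun x y => 1 / (cigar_E rho t + x ^ 2 + y ^ 2))).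
    { apply smooth_mult; [apply smooth_const | apply smooth_cigar_factor]. }
    intros [] []; solve [exact H | exact (smooth_const 0)].
  - now intros [] [] x y.
  - intros x y v [k Hk]; unfold sum_axis, cigar_metric.
    (* The quadratic form is |v|^2 / D; the nonzero component [v k] makes |v|^2 strictly
       positive. *)
    replace (_ + _) with
      ((v ax_x ^ 2 + v ax_y ^ 2) * / (cigar_E rho t + x ^ 2 + y ^ 2))
      by (unfold Rdiv; ring).
    apply Rmult_lt_0_compat;
      [|apply Rinv_0_lt_compat, cigar_denominator_pos].
    assert (Hx := pow2_ge_0 (v ax_x)); assert (Hy := pow2_ge_0 (v ax_y)).
    assert (H := Rlt_0_sqr (v k) Hk); rewrite Rsqr_pow2 in H; destruct k; lra.
Qed.

Lemma cigar_potential_smooth (rho : R) :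
  smooth_vector_field (cigar_potential rho).
Proof.
  intros []; unfold cigar_potential; apply smooth_mult;
    auto using smooth_const, smooth_x, smooth_y.
Qed.

(** * Lie derivatives of multiples of the flat metric *)

Definition conformal (h : scalar_field) : tensor02 :=
  fun i j x y =>
    match i, j with
    | ax_x, ax_x | ax_y, ax_y => h x y
    | _, _ => 0
    end.

(** Allows the inner Lie derivative, computed only pointwise, to be replaced under the outer one
    without functional extensionality. *)
Lemma lie_derivative_ext (V : vector_field) (h1 h2 : tensor02) :
  (forall i j x y, h1 i j x y = h2 i j x y) ->
  forall i j x y, lie_derivative V h1 i j x y = lie_derivative V h2 i j x y.
Proof.
  intros H i j x y; unfold lie_derivative, sum_axis.
  assert (Hp : forall k, partial k (h1 i j) x y = partial k (h2 i j) x y).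
  { intros []; apply Derive_ext; intros s; apply H. }
  now rewrite !Hp, !H.
Qed.

Lemma partial_cigar_potential (rho : R) (i k : axis) (x y : R) :
  partial i (cigar_potential rho k) x y =
  match i, k with
  | ax_x, ax_x | ax_y, ax_y => - 2 * (1 - 2 * rho)
  | _, _ => 0
  end.
Proof.
  destruct i, k; apply is_derive_unique; unfold cigar_potential;
    auto_derive; auto; ring.
Qed.

(** The Jacobian of xi is c times the identity, so its two terms contribute 2 c h on the diagonal
    and nothing off it. The partials of h are parameters, to be supplied in closed form. *)
Lemma lie_derivative_conformal (rho : R) (h hx hy : scalar_field) :
  (forall x y, is_derive (fun z => h z y) x (hx x y)) ->
  (forall x y, is_derive (fun z => h x z) y (hy x y)) ->
  forall i j x y,
  lie_derivative (cigar_potential rho) (conformal h) i j x y =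
  conformal (fun x y =>
    - 2 * (1 - 2 * rho) * (x * hx x y + y * hy x y + 2 * h x y)) i j x y.
Proof.
  intros Hx Hy i j x y; unfold lie_derivative, sum_axis.
  rewrite !partial_cigar_potential.
  assert (Ex : Derive (fun s => h s y) x = hx x y)
    by apply is_derive_unique, Hx.
  assert (Ey : Derive (fun s => h x s) y = hy x y)
    by apply is_derive_unique, Hy.
  destruct i, j; unfold conformal, cigar_potential, partial;
    rewrite ?Ex, ?Ey, ?Derive_const; ring.
Qed.

(** For h = 1/D, x h_x + y h_y + 2 h = (2 D - 2 r^2) / D^2 = 2 E / D^2. *)
Lemma lie_derivative_cigar_metric (rho t : R) (i j : axis) (x y : R) :
  lie_derivative (cigar_potential rho) (cigar_metric rho t) i j x y =
  conformal (fun x y => 2 * (- 2 * (1 - 2 * rho)) * cigar_E rho t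
                        / (cigar_E rho t + x ^ 2 + y ^ 2) ^ 2) i j x y.
Proof.
  assert (HD := cigar_denominator_pos rho t).
  (* [conformal] matches on the indices exactly as [cigar_metric] does, so the two are
     convertible. *)
  change (cigar_metric rho t) with
    (conformal (fun x y => 1 / (cigar_E rho t + x ^ 2 + y ^ 2))).
  rewrite lie_derivative_conformal with
    (hx := fun x y => - (2 * x) / (cigar_E rho t + x ^ 2 + y ^ 2) ^ 2)
    (hy := fun x y => - (2 * y) / (cigar_E rho t + x ^ 2 + y ^ 2) ^ 2).
  - specialize (HD x y); destruct i, j; unfold conformal; auto; field; lra.
  - intros u v; specialize (HD u v); auto_derive; [lra | field; lra].
  - intros u v; specialize (HD u v); auto_derive; [lra | field; lra].
Qed.

Theorem proposition3p3 (rho t : R) :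
  mixed_killing (cigar_metric rho t) (cigar_potential rho).
Proof.
  assert (HD := cigar_denominator_pos rho t).
  split; [apply cigar_metric_riemannian|].
  split; [apply cigar_potential_smooth|].
  (* This is f = 2 c (E - r^2) / D, spelled with sums, products and an inverse to fit the smoothness
     lemmas. *)
  exists (fun x y => 2 * (- 2 * (1 - 2 * rho))
                     * (cigar_E rho t + (-1) * (x * x + y * y))
                     * / (cigar_E rho t + x ^ 2 + y ^ 2)); split.
  - apply smooth_mult; [|apply smooth_cigar_factor].
    apply smooth_mult; [apply smooth_const|].
    apply smooth_plus; [apply smooth_const|].
    apply smooth_mult; [apply smooth_const|].
    apply smooth_plus; auto using smooth_mult, smooth_x, smooth_y.
  - intros i j x y.
    rewrite (lie_derivative_ext _ _ _ (lie_derivative_cigar_metric rho t)).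
    rewrite lie_derivative_cigar_metric.
    (* Now h = 2 c E / D^2, with partials - 8 c E x / D^3 and - 8 c E y / D^3. Hence c (x h_x + y
       h_y + 2 h) = 4 c^2 E (D - 2 r^2) / D^3, and D - 2 r^2 = E - r^2 gives f h. *)
    rewrite lie_derivative_conformal with
      (hx := fun x y => - (8 * (- 2 * (1 - 2 * rho)) * cigar_E rho t * x)
                        / (cigar_E rho t + x ^ 2 + y ^ 2) ^ 3)
      (hy := fun x y => - (8 * (- 2 * (1 - 2 * rho)) * cigar_E rho t * y)
                        / (cigar_E rho t + x ^ 2 + y ^ 2) ^ 3).
    + specialize (HD x y); destruct i, j; unfold conformal;
        solve [ring | field; lra].
    + intros u v; specialize (HD u v); auto_derive;
        [apply Rgt_not_eq; nra | field; lra].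
    + intros u v; specialize (HD u v); auto_derive;
        [apply Rgt_not_eq; nra | field; lra].
Qed.
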